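(* Let $k$ be a field of characteristic not $2$. The association $(V,E)\mapsto (k(V),\Omega^1(V,E),\mathrm{d})$ of a differential algebra to each finite digraph extends to a full and faithful (contravariant) functor $\mathrm{Digraph}\to\mathrm{DiffAlg}$, which sends a digraph morphism $\psi:(W,F)\to(V,E)$ to the morphism $(\phi,\phi_* )$ with $\phi:k(V)\to k(W)$, $\phi(f)=f\circ\psi$, and $$\phi_*:\Omega^1(V,E)\to\Omega^1(W,F),\qquad \phi_*(\omega_{x\to y})=\sum_{w\to z\in F,\ w\in\psi^{-1}(x),\ z\in\psi^{-1}(y)}\omega_{w\to z}.$$
   Context: Digraphs: a digraph $(V,E)$ is a finite set $V$ with a set of arrows $E\subseteq V\times V\setminus\mathrm{diagonal}$; write $x\to y$ for $(x,y)\in E$. A morphism $(W,F)\to(V,E)$ in the category $\mathrm{Digraph}$ is a map $\psi:W\to V$ such that for every $w\to z$ in $F$ either $\psi(w)=\psi(z)$ or $\psi(w)\to\psi(z)$ is in $E$. Differential algebras: a differential algebra $(A,\Omega^1,\mathrm{d})$ is a unital $k$-algebra $A$, an $A$-$A$-bimodule $\Omega^1$ and a linear map $\mathrm{d}:A\to\Omega^1$ with $\mathrm{d}(fg)=(\mathrm{d}f)g+f\,\mathrm{d}g$ such that $A\otimes A\to\Omega^1$, $f\otimes g\mapsto f\,\mathrm{d}g$, is surjective. A morphism $(A,\Omega^1(A),\mathrm{d})\to(B,\Omega^1(B),\mathrm{d})$ in the category $\mathrm{DiffAlg}$ is a unital algebra map $\phi:A\to B$ together with a compatible map $\phi_*:\Omega^1(A)\to\Omega^1(B)$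 (linear, with $\phi_*(f\omega)=\phi(f)\phi_*(\omega)$ and $\phi_*(\omega f)=\phi_*(\omega)\phi(f)$) such that $\phi_*\mathrm{d}=\mathrm{d}\phi$; such $\phi_*$ is unique if it exists. Association: $k(V)$ is the algebra of $k$-valued functions on $V$ with pointwise product; $\Omega^1(V,E)=kE$ has basis $\{\omega_{x\to y}\mid x\to y\in E\}$, with $f\omega_{x\to y}=f(x)\omega_{x\to y}$, $\omega_{x\to y}f=f(y)\omega_{x\to y}$ and $\mathrm{d}f=\sum_{x\to y\in E}(f(y)-f(x))\omega_{x\to y}$. *)

(* Defs.v *)
From HB Require Import structures.
From mathcomp Require Import all_boot all_order all_algebra.
From mathcomp Require Import boolp.

Set Implicit Arguments.
Unset Strict Implicit.
Unset Printing Implicit Defensive.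

Import GRing.Theory.
Local Open Scope ring_scope.

(** * Categories and contravariant functors *)

Record category := Category {
  object :> Type;
  hom : object -> object -> Type;
  idm : forall X, hom X X;
  comp : forall X Y Z, hom Y Z -> hom X Y -> hom X Z;
  comp_idl : forall X Y (f : hom X Y), comp (idm Y) f = f;
  comp_idr : forall X Y (f : hom X Y), comp f (idm X) = f;
  comp_assoc : forall X Y Z T (h : hom Z T) (g : hom Y Z) (f : hom X Y),
    comp h (comp g f) = comp (comp h g) f
}.
Arguments idm {c} X.
Arguments comp {c X Y Z}.

(* [F1] makes the map on objects [F0] into a contravariant functor. *)
Definition contrafunctor (C D : category) (F0 : C -> D)
    (F1 : forall X Y : C, hom X Y -> hom (F0 Y) (F0 X)) : Prop :=
  (forall X : C, F1 X X (idm X) = idm (F0 X)) /\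
  (forall (X Y Z : C) (g : hom Y Z) (f : hom X Y),
     F1 X Z (comp g f) = comp (F1 X Y f) (F1 Y Z g)).

Definition contrafull (C D : category) (F0 : C -> D)
    (F1 : forall X Y : C, hom X Y -> hom (F0 Y) (F0 X)) : Prop :=
  forall (X Y : C) (g : hom (F0 Y) (F0 X)), exists f : hom X Y, F1 X Y f = g.

Definition contrafaithful (C D : category) (F0 : C -> D)
    (F1 : forall X Y : C, hom X Y -> hom (F0 Y) (F0 X)) : Prop :=
  forall (X Y : C) (f g : hom X Y), F1 X Y f = F1 X Y g -> f = g.

(** * Digraphs *)

Record digraph := Digraph_ {
  vertex :> finType;
  edge : rel vertex;
  edge_irr : irreflexive edge
}.

Record digraph_hom (W V : digraph) := DigraphHom {
  vmap :> W -> V;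
  vmapP : forall w z, edge w z -> vmap w = vmap z \/ edge (vmap w) (vmap z)
}.

Lemma digraph_hom_eq (W V : digraph) (f g : digraph_hom W V) :
  f =1 g -> f = g.
Proof.
case: f g => [f fP] [g gP] /= /funext eq_fg.
by move: fP gP; rewrite eq_fg => fP gP; congr DigraphHom; apply: Prop_irrelevance.
Qed.

Definition digraph_id (V : digraph) : digraph_hom V V :=
  @DigraphHom V V id (fun w z wz => or_intror wz).

Lemma digraph_compP (U W V : digraph) (g : digraph_hom W V)
    (f : digraph_hom U W) w z :
  edge w z -> g (f w) = g (f z) \/ edge (g (f w)) (g (f z)).
Proof.
by case/(vmapP f) => [->|/(vmapP g)//]; left.
Qed.

Definition digraph_comp (U W V : digraph) (g : digraph_hom W V)
    (f : digraph_hom U W) : digraph_hom U V :=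
  @DigraphHom U V (fun x => g (f x)) (@digraph_compP U W V g f).

Definition Digraph : category.
Proof.
by apply: (@Category digraph digraph_hom digraph_id digraph_comp) => *;
  apply: digraph_hom_eq.
Defined.

(** * Differential algebras *)

(* The library's [algType] requires [1 != 0]. Here the zero algebra must be
   allowed, since it is the algebra of functions on the empty digraph. *)
Record kalgebra (k : fieldType) := KAlgebra {
  kalg_ring : pzRingType;
  kalg_scale : k -> kalg_ring -> kalg_ring;
  kalg_scaleA : forall a b x,
    kalg_scale a (kalg_scale b x) = kalg_scale (a * b) x;
  kalg_scale1 : left_id 1 kalg_scale;
  kalg_scaleDr : right_distributive kalg_scale +%R;
  kalg_scaleDl : forall x, {morph kalg_scale^~ x : a b / a + b};
  kalg_scaleAl : forall a x y, kalg_scale a (x * y) = kalg_scale a x * y;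
  kalg_scaleAr : forall a x y, kalg_scale a (x * y) = x * kalg_scale a y
}.

Definition kalg_sort (k : fieldType) (A : kalgebra k) : Type := kalg_ring A.
Coercion kalg_sort : kalgebra >-> Sortclass.

HB.instance Definition _ (k : fieldType) (A : kalgebra k) :=
  GRing.PzRing.copy (kalg_sort A) (kalg_ring A).
HB.instance Definition _ (k : fieldType) (A : kalgebra k) :=
  GRing.Zmodule_isLmodule.Build k (kalg_sort A) (@kalg_scaleA k A)
    (@kalg_scale1 k A) (@kalg_scaleDr k A) (@kalg_scaleDl k A).

(* The left and right actions of [A] are bilinear over [k], hence both restrict
   to the given action of [k]. *)
Record bimodule (k : fieldType) (A : kalgebra k) := Bimodule {
  bimod_sort :> lmodType k;
  lact : A -> bimod_sort -> bimod_sort;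
  ract : bimod_sort -> A -> bimod_sort;
  lact_linearl : forall w, linear (lact^~ w);
  lact_linearr : forall f, linear (lact f);
  ract_linearl : forall f, linear (ract^~ f);
  ract_linearr : forall w, linear (ract w);
  lact1 : forall w, lact 1 w = w;
  ract1 : forall w, ract w 1 = w;
  lactA : forall f g w, lact f (lact g w) = lact (f * g) w;
  ractA : forall w f g, ract (ract w f) g = ract w (f * g);
  lractA : forall f w g, ract (lact f w) g = lact f (ract w g)
}.

(* [diffalg_surj] is the surjectivity of [f (x) g |-> f dg] on the tensor
   product [A (x) A], whose elements are the finite sums of pure tensors. *)
Record diffalg (k : fieldType) := DiffAlg_ {
  dalg : kalgebra k;
  forms1 : bimodule dalg;
  dd : dalg -> forms1;
  dd_linear : linear dd;
  dd_leibniz : forall f g, dd (f * g) = ract (dd f) g + lact f (dd g);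
  diffalg_surj : forall w : forms1, exists s : seq (dalg * dalg),
    w = \sum_(p <- s) lact p.1 (dd p.2)
}.
Arguments dd {k d}.

Record diffalg_hom (k : fieldType) (A B : diffalg k) := DiffAlgHom {
  amap : dalg A -> dalg B;
  fmap : forms1 A -> forms1 B;
  amap_linear : linear amap;
  amap_monoid : GRing.monoid_morphism amap;
  fmap_linear : linear fmap;
  fmap_lact : forall f w, fmap (lact f w) = lact (amap f) (fmap w);
  fmap_ract : forall w f, fmap (ract w f) = ract (fmap w) (amap f);
  fmap_dd : forall f, fmap (dd f) = dd (amap f)
}.

Lemma diffalg_hom_eq (k : fieldType) (A B : diffalg k)
    (F G : diffalg_hom A B) :
  amap F =1 amap G -> fmap F =1 fmap G -> F = G.
Proof.
case: F G => [f f' f1 f2 f3 f4 f5 f6] [g g' g1 g2 g3 g4 g5 g6] /=.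
move=> /funext eq_fg /funext eq_fg'; subst g g'.
by congr DiffAlgHom; apply: Prop_irrelevance.
Qed.

Definition diffalg_id (k : fieldType) (A : diffalg k) : diffalg_hom A A.
Proof. by exists id id. Defined.

Definition diffalg_comp (k : fieldType) (A B C : diffalg k)
  (G : diffalg_hom B C) (F : diffalg_hom A B) : diffalg_hom A C.
Proof.
exists (fun f => amap G (amap F f)) (fun w => fmap G (fmap F w)).
- by move=> a x y; rewrite !amap_linear.
- by split=> [|x y]; rewrite ?(amap_monoid F).1 ?(amap_monoid G).1
    ?(amap_monoid F).2 ?(amap_monoid G).2.
- by move=> a x y; rewrite !fmap_linear.
- by move=> f w; rewrite !fmap_lact.
- by move=> f w; rewrite !fmap_ract.
- by move=> f; rewrite !fmap_dd.
Defined.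

Definition DiffAlg (k : fieldType) : category.
Proof.
by apply: (@Category (diffalg k) (@diffalg_hom k) (@diffalg_id k)
  (@diffalg_comp k)) => *; apply: diffalg_hom_eq.
Defined.

(** * The differential algebra of a digraph *)

Definition funalg (k : fieldType) (T : finType) : kalgebra k.
Proof.
apply: (@KAlgebra k {ffun T -> k^o} (fun a f => a *: f)).
- exact: scalerA.
- exact: scale1r.
- exact: scalerDr.
- by move=> f a b; rewrite scalerDl.
- by move=> a f g; apply/ffunP => x; rewrite !ffunE scalerAl.
- by move=> a f g; apply/ffunP => x; rewrite !ffunE scalerAr.
Defined.

Definition arrow (V : digraph) := {e : V * V | edge e.1 e.2}.

Definition src (V : digraph) (e : arrow V) : V := (val e).1.
Definition tgt (V : digraph) (e : arrow V) : V := (val e).2.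

Section DigraphForms.
Variables (k : fieldType) (V : digraph).

Definition kE : lmodType k := {ffun arrow V -> k^o}.

Definition omega (e : arrow V) : kE := [ffun e' => (e' == e)%:R].

Lemma kE_basis (w : kE) : w = \sum_e w e *: omega e.
Proof.
apply/ffunP => e; rewrite sum_ffunE (bigD1 e) //= big1 => [|e' ne'e].
  by rewrite !ffunE eqxx addr0 [RHS]mulr1.
by rewrite !ffunE eq_sym (negPf ne'e) scaler0.
Qed.

Definition kE_lact (f : {ffun V -> k^o}) (w : kE) : kE :=
  [ffun e => f (src e) * w e].
Definition kE_ract (w : kE) (f : {ffun V -> k^o}) : kE :=
  [ffun e => w e * f (tgt e)].

Lemma kE_lact_omega f e : kE_lact f (omega e) = f (src e) *: omega e.
Proof.
apply/ffunP => e'; rewrite !ffunE.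
by case: eqP => [->|_]; rewrite ?mulr0 ?scaler0.
Qed.

Lemma kE_ract_omega f e : kE_ract (omega e) f = f (tgt e) *: omega e.
Proof.
apply/ffunP => e'; rewrite !ffunE.
by case: eqP => [->|_]; rewrite ?mul0r ?scaler0 // mul1r [RHS]mulr1.
Qed.

Definition kE_bimodule : bimodule (funalg k V).
Proof.
exists kE kE_lact kE_ract.
- by move=> w a f g; apply/ffunP => e; rewrite !ffunE mulrDl -scalerAl.
- by move=> f a w u; apply/ffunP => e; rewrite !ffunE mulrDr -scalerAr.
- by move=> f a w u; apply/ffunP => e; rewrite !ffunE mulrDl -scalerAl.
- by move=> w a f g; apply/ffunP => e; rewrite !ffunE mulrDr -scalerAr.
- by move=> w; apply/ffunP => e; rewrite !ffunE mul1r.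
- by move=> w; apply/ffunP => e; rewrite !ffunE mulr1.
- by move=> f g w; apply/ffunP => e; rewrite !ffunE mulrA.
- by move=> w f g; apply/ffunP => e; rewrite !ffunE mulrA.
- by move=> f w g; apply/ffunP => e; rewrite !ffunE mulrA.
Defined.

Definition kE_d (f : {ffun V -> k^o}) : kE_bimodule :=
  \sum_(e : arrow V) (f (tgt e) - f (src e)) *: omega e.

Lemma kE_dE (f : {ffun V -> k^o}) (e : arrow V) :
  (kE_d f : kE) e = f (tgt e) - f (src e).
Proof.
rewrite [kE_d f](_ : _ = [ffun e => f (tgt e) - f (src e)] :> kE) ?ffunE //.
by rewrite [RHS]kE_basis; apply: eq_bigr => e' _; rewrite ffunE.
Qed.

Definition digraph_diffalg : diffalg k.
Proof.
exists (funalg k V) kE_bimodule kE_d.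
- by move=> a f g; apply/ffunP => e; rewrite !(ffunE, kE_dE) scalerBr opprD addrACA.
- move=> f g; apply/ffunP => e; rewrite ffunE [kE_ract _ _ _]ffunE.
  rewrite [kE_lact _ _ _]ffunE !kE_dE !ffunE.
  by rewrite mulrBl mulrBr addrA subrK.
- move=> w; pose pt (x : V) : {ffun V -> k^o} := [ffun y => (y == x)%:R].
  exists [seq (w e *: pt (src e), pt (tgt e)) | e <- enum {: arrow V}].
  rewrite big_map big_enum [LHS]kE_basis; apply: eq_bigr => e _ /=.
  apply/ffunP => e'; rewrite [RHS]ffunE kE_dE !ffunE -[RHS]scalerAl.
  congr (_ *: _).
  have [->|ne] := eqVneq e' e.
    rewrite !eqxx mul1r; case: eqP => [est|_]; last by rewrite subr0.
    by have := valP e; rewrite -/(src e) -/(tgt e) est edge_irr.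
  have [es|] := eqVneq (src e') (src e); last by rewrite mul0r.
  rewrite mul1r; have [et|_] := eqVneq (tgt e') (tgt e).
    by case/eqP: ne; apply: val_inj; rewrite [LHS]surjective_pairing
      [RHS]surjective_pairing; congr pair.
  have [st|_] := eqVneq (src e') (tgt e); last by rewrite subr0.
  by have := valP e; rewrite -/(src e) -/(tgt e) -es st edge_irr.
Defined.

End DigraphForms.

(* Main.v *)
Require Import Defs.
From mathcomp Require Import all_boot all_order all_algebra.
Set Implicit Arguments.
Unset Strict Implicit.
Unset Printing Implicit Defensive.
Import GRing.Theory.
Local Open Scope ring_scope.

(** Functions pull back along any map of vertices. A form on a digraph is a
    function on its arrows; extended by zero to all pairs of vertices, it pulls
    back along pairs in the same way, and this is the formula for [phi_*]. The
    pullback commutes with [d] exactly because a digraph morphism sends an arrow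
    either to an arrow, where the extension of [df] is [f y - f x], or to a
    diagonal pair, where the extension and [f y - f x] both vanish.

    Since the forms [f dg] span, a morphism of differential algebras is
    determined by its map on functions ([diffalg_hom_amap_inj]). Functoriality
    and faithfulness thus concern only functions, which separate vertices.

    For fullness, let [phi : k(V) -> k(W)] be a unital algebra map. For each
    vertex [w], the scalars [phi(delta_x)(w)] have sum [1], so one of them is
    nonzero, say at [x = psi w]; applying [phi] to [f delta_x = f(x) delta_x] and
    cancelling gives [phi(f)(w) = f(psi w)] ([character_eval]). If [w -> z] but
    [psi w], [psi z] were neither equal nor joined by an arrow, then
    [delta_(psi w) d delta_(psi z)] would be zero while its image has coefficient
    [1] at [w -> z]; hence a compatible [phi_*] forces [psi] to be a digraph
    morphism ([vmapP_of_diffalg_hom]). *)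

(** * Morphisms of differential algebras are determined on functions *)

(** Every form is a finite sum of terms [f dg], whose images are prescribed. *)
Lemma diffalg_hom_amap_inj (k : fieldType) (A B : diffalg k)
    (F G : diffalg_hom A B) :
  amap F =1 amap G -> F = G.
Proof.
move=> eqFG; apply: diffalg_hom_eq => // w.
have fmap0 (H : diffalg_hom A B) : fmap H 0 = 0.
  by have := fmap_linear H (-1) 0 0; rewrite !scaleN1r !addNr.
have fmapD (H : diffalg_hom A B) : {morph fmap H : u v / u + v}.
  by move=> u v; have := fmap_linear H 1 u v; rewrite !scale1r.
have [s ->] := diffalg_surj w.
rewrite !(big_morph _ (fmapD _) (fmap0 _)); apply: eq_bigr => p _.
by rewrite !fmap_lact !fmap_dd !eqFG.
Qed.

(** * The pullback along a digraph morphism *)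

Section Pullback.
Variable k : fieldType.

(** A map of vertices acts on pairs of vertices but not on arrows, so forms are
    extended by zero to pairs before being pulled back. *)
Definition coef (V : digraph) (u : kE k V) (p : V * V) : k :=
  oapp u 0 (insub p : option (arrow V)).

Lemma coef_linear (V : digraph) (a : k) (u v : kE k V) p :
  coef (a *: u + v) p = a * coef u p + coef v p.
Proof.
rewrite /coef; case: insub => [e|] /=; last by rewrite mulr0 addr0.
by rewrite !ffunE.
Qed.

Lemma coef_lact (V : digraph) (f : {ffun V -> k^o}) (u : kE k V) p :
  coef (kE_lact f u) p = f p.1 * coef u p.
Proof.
rewrite /coef; case: insubP => [e _ <-|_] /=; last by rewrite mulr0.
by rewrite ffunE.
Qed.

Lemma coef_ract (V : digraph) (f : {ffun V -> k^o}) (u : kE k V) p :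
  coef (kE_ract u f) p = coef u p * f p.2.
Proof.
rewrite /coef; case: insubP => [e _ <-|_] /=; last by rewrite mul0r.
by rewrite ffunE.
Qed.

Lemma coef_d (V : digraph) (f : {ffun V -> k^o}) x y :
  x = y \/ edge x y -> coef (kE_d f : kE k V) (x, y) = f y - f x.
Proof.
rewrite /coef; case: insubP => [e _ e_xy|/negPf /= ne_xy] /=.
  by move=> _; rewrite kE_dE /src /tgt e_xy.
by case=> [->|]; rewrite ?subrr ?ne_xy.
Qed.

Lemma coef_omega (V : digraph) (e : arrow V) p :
  coef (omega k e) p = (p == val e)%:R.
Proof.
rewrite /coef; case: insubP => [e' _ <-|ne_p] /=.
  by rewrite ffunE (inj_eq val_inj).
by case: eqP ne_p => // ->; rewrite (valP e).
Qed.

Variables (W V : digraph) (psi : digraph_hom W V).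

Definition pull0 (f : {ffun V -> k^o}) : {ffun W -> k^o} :=
  [ffun w => f (psi w)].

Definition pull1 (u : kE k V) : kE k W :=
  [ffun b => coef u (psi (src b), psi (tgt b))].

Definition pullback :
  diffalg_hom (digraph_diffalg k V) (digraph_diffalg k W).
Proof.
apply: (@DiffAlgHom k (digraph_diffalg k V) (digraph_diffalg k W) pull0 pull1).
- by move=> a f g; apply/ffunP => w; rewrite !ffunE.
- by split=> [|f g]; apply/ffunP => w; rewrite !ffunE.
- by move=> a u v; apply/ffunP => b; rewrite !ffunE coef_linear.
- by move=> f u; apply/ffunP => b; rewrite !ffunE coef_lact.
- by move=> u f; apply/ffunP => b; rewrite !ffunE coef_ract.
- move=> f; apply/ffunP => b; rewrite [LHS]ffunE [RHS]kE_dE !ffunE.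
  exact: coef_d (vmapP psi (valP b)).
Defined.

Lemma pull1_omega (a : arrow V) :
  pull1 (omega k a) =
    \sum_(b | (psi (src b) == src a) && (psi (tgt b) == tgt a)) omega k b.
Proof.
apply/ffunP => b; rewrite ffunE coef_omega sum_ffunE.
rewrite -[_ == val a]/((psi (src b) == src a) && (psi (tgt b) == tgt a)).
have [Pb|nPb] := boolP ((psi (src b) == src a) && (psi (tgt b) == tgt a)).
  rewrite (bigD1 b) //= big1 => [|c /andP[_ /negPf ne_cb]].
    by rewrite ffunE eqxx addr0.
  by rewrite ffunE eq_sym ne_cb.
rewrite big1 // => c Pc; rewrite ffunE.
by have [bc|//] := eqVneq b c; rewrite bc Pc in nPb.
Qed.

End Pullback.

(** * Algebra maps between function algebras *)

Section Fullness.
Variable k : fieldType.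

Definition delta (T : finType) (x : T) : {ffun T -> k^o} :=
  [ffun y => (y == x)%:R].

Lemma delta_sum (T : finType) (f : {ffun T -> k^o}) :
  f = \sum_x f x *: delta x.
Proof.
apply/ffunP => y; rewrite sum_ffunE (bigD1 y) //= big1 => [|x ne_xy].
  by rewrite !ffunE eqxx addr0 [RHS]mulr1.
by rewrite !ffunE eq_sym (negPf ne_xy) scaler0.
Qed.

(** A finite set [T] is recovered from the algebra [k^T] as its set of
    characters. *)
Lemma character_eval (T : finType) (chi : {ffun T -> k^o} -> k) :
  (forall a f g, chi (a *: f + g) = a * chi f + chi g) ->
  chi [ffun=> 1] = 1 ->
  (forall f g : {ffun T -> k^o}, chi [ffun x => f x * g x] = chi f * chi g) ->
  exists x, forall f, chi f = f x.
Proof.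
move=> chiL chi1 chiM.
have chiD : {morph chi : f g / f + g}.
  by move=> f g; rewrite -[f in LHS]scale1r chiL mul1r.
have chi0 : chi 0 = 0.
  by apply: (@addrI _ (chi 0)); rewrite -chiD !addr0.
have chiZ a f : chi (a *: f) = a * chi f.
  by rewrite -[a *: f]addr0 chiL chi0 addr0.
have chiE f : chi f = \sum_x f x * chi (delta x).
  rewrite {1}[f]delta_sum (big_morph _ chiD chi0).
  by apply: eq_bigr => x _; rewrite chiZ.
have [x nz_x] : exists x, chi (delta x) != 0.
  apply/existsP; apply: contraNT (oner_neq0 k) => /existsPn chi_0.
  rewrite -chi1 chiE big1 // => x _.
  by have /negPn/eqP-> := chi_0 x; rewrite mulr0.
exists x => f.
(* [f delta_x = f(x) delta_x], and [chi delta_x] can be cancelled. *)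
apply: (mulIf nz_x); rewrite -chiM -chiZ; congr chi.
apply/ffunP => y; rewrite !ffunE.
by case: eqP => [->|_] //; rewrite mulr0 scaler0.
Qed.

Lemma funalg_hom_comp (W V : digraph)
    (G : diffalg_hom (digraph_diffalg k V) (digraph_diffalg k W)) :
  exists psi : W -> V, forall (f : {ffun V -> k^o}),
    amap G f = [ffun w => f (psi w)].
Proof.
have /fin_all_exists[psi psiP] (w : W) : exists x : V,
    forall f : {ffun V -> k^o}, (amap G f : {ffun W -> k^o}) w = f x.
  apply: (@character_eval V (fun f => (amap G f : {ffun W -> k^o}) w)).
  - by move=> a f g; rewrite [amap G _]amap_linear !ffunE.
  - have := (amap_monoid G).1 => /(congr1 (fun f : {ffun W -> k^o} => f w)).
    by rewrite !ffunE.
  - move=> f g; have := (amap_monoid G).2 f g.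
    by move/(congr1 (fun f : {ffun W -> k^o} => f w)); rewrite ffunE.
by exists psi => f; apply/ffunP => w; rewrite psiP ffunE.
Qed.

(** When [psi w] and [psi z] differ, the form [delta_(psi w) d delta_(psi z)] can
    only have a nonzero coefficient at an arrow [psi w -> psi z], while its image
    under [G] has coefficient [1] at [w -> z]. *)
Lemma vmapP_of_diffalg_hom (W V : digraph)
    (G : diffalg_hom (digraph_diffalg k V) (digraph_diffalg k W))
    (psi : W -> V) :
  (forall f : {ffun V -> k^o}, amap G f = [ffun w => f (psi w)]) ->
  forall w z, edge w z -> psi w = psi z \/ edge (psi w) (psi z).
Proof.
move=> GE w z wz; have [|ne_wz] := eqVneq (psi w) (psi z); first by left.
right; apply: contraT => /negPf nwz.
pose form : forms1 (digraph_diffalg k V) :=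
  kE_lact (delta (psi w)) (kE_d (delta (psi z))).
have form0 : form = 0.
  apply/ffunP => e; rewrite !ffunE kE_dE !ffunE.
  have [es|] := eqVneq (src e) (psi w); last by rewrite mul0r.
  have [et|_] := eqVneq (tgt e) (psi z).
    by have := valP e; rewrite -/(src e) -/(tgt e) es et nwz.
  by rewrite es (negPf ne_wz) subrr mulr0.
have : fmap G form = 0.
  by rewrite form0; have := fmap_linear G (-1) 0 0; rewrite !scaleN1r !addNr.
rewrite [fmap G form]fmap_lact [fmap G _]fmap_dd !GE.
pose b : arrow W := Sub (w, z) wz.
move/(congr1 (fun u : kE k W => u b)); rewrite !ffunE kE_dE !ffunE /src /tgt /=.
by rewrite !eqxx (negPf ne_wz) subr0 mulr1 => /eqP; rewrite oner_eq0.
Qed.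

End Fullness.

Theorem theorem3p1 (k : fieldType) (char_k : 2%N \notin [pchar k]) :
  exists F : forall W V : digraph, digraph_hom W V ->
               diffalg_hom (digraph_diffalg k V) (digraph_diffalg k W),
    [/\ @contrafunctor Digraph (DiffAlg k) (digraph_diffalg k) F,
        @contrafull Digraph (DiffAlg k) (digraph_diffalg k) F,
        @contrafaithful Digraph (DiffAlg k) (digraph_diffalg k) F
      & forall (W V : digraph) (psi : digraph_hom W V),
          (forall f : {ffun V -> k^o},
             amap (F W V psi) f = [ffun w => f (psi w)]) /\
          (forall a : arrow V,
             fmap (F W V psi) (omega k a) =
               \sum_(b : arrow W | (psi (src b) == src a)
                                   && (psi (tgt b) == tgt a)) omega k b)].
Proof.
exists (@pullback k); split.
- split=> [V|U W V g f]; apply: diffalg_hom_amap_inj => u;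
    by apply/ffunP => x; rewrite !ffunE.
- move=> W V G; have [psi psiE] := funalg_hom_comp G.
  exists (DigraphHom (vmapP_of_diffalg_hom psiE)).
  by apply: diffalg_hom_amap_inj => f; rewrite psiE.
- move=> W V f g eq_fg; apply: digraph_hom_eq => w.
  have := congr1 (fun H : diffalg_hom (digraph_diffalg k V)
    (digraph_diffalg k W) => (amap H (delta k (g w)) : {ffun W -> k^o}) w) eq_fg.
  rewrite /= !ffunE eqxx.
  by case: eqP => // _ /eqP; rewrite eq_sym oner_eq0.
- by move=> W V psi; split=> [f|a] //; apply: pull1_omega.
Qed.
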